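(* Let $p\ge 1$ and let $\mathfrak g$ be a $(2p+1)$-dimensional Lie algebra over $\mathbb K$ ($\mathbb K=\mathbb R$ or $\mathbb C$) which admits a contact form, i.e. a linear form $\omega\in\mathfrak g^*$ with $\omega\wedge(d\omega)^p\neq 0$. Then $\mathfrak g$ is isomorphic to a quadratic formal deformation of the Heisenberg algebra $\mathfrak h_{2p+1}$.
   Context: For a Lie algebra $\mathfrak g$ and $\omega\in\mathfrak g^*$, $d\omega\in\Lambda^2(\mathfrak g^* )$ is defined by $d\omega(X,Y)=-\omega([X,Y])$. The Heisenberg algebra $\mathfrak h_{2p+1}$ is the $(2p+1)$-dimensional Lie algebra with basis $X_1,\dots,X_{2p+1}$ and bracket $\mu_0$ given by $\mu_0(X_{2k-1},X_{2k})=X_{2p+1}$ for $k=1,\dots,p$, all other brackets of basis vectors (not following by skew-symmetry) being zero. A formal deformation of a Lie algebra $\mathfrak g_0=(V,\mu_0)$ is a Lie algebra $\mathfrak g_t$ on the same underlying vector space $V$ with bracket $\mu_t=\mu_0+t\varphi_1+t^2\varphi_2+\cdots+t^n\varphi_n+\cdots$, where the $\varphi_i:V\times V\to V$ are skew-symmetric bilinear maps and the Jacobi identity for $\mu_t$ holds identically in $t$ (coefficient by coefficient in powers of $t$). It is called quadratic if $\varphi_i=0$ for all $i\ge 3$. Thus a quadratic formal deformation is $\mu_t=\mu_0+t\varphi_1+t^2\varphi_2$, and in that case $\mu_t$ is a Lie bracket on $V$ for every $t\in\mathbb K$. Saying that $\mathfrak g$ is isomorphic to the deformation means that $\mathfrak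 g$ is isomorphic to the Lie algebra $(V,\mu_t)$ for nonzero values $t\in\mathbb K$ of the parameter. *)

(* Defs.v *)
From HB Require Import structures.
From mathcomp Require Import all_boot all_order all_fingroup all_algebra.
From mathcomp Require Import complex reals.

Set Implicit Arguments.
Unset Strict Implicit.
Unset Printing Implicit Defensive.

Import Order.TTheory GRing.Theory Num.Theory.
Local Open Scope ring_scope.
Local Open Scope complex_scope.

(* [R : realType] is an arbitrary model of the real numbers. *)
Inductive real_or_complex (R : realType) : numFieldType -> Prop :=
| Ground_real : real_or_complex R R
| Ground_complex : real_or_complex R R[i].

Section LieAlgebras.
Variables (K : numFieldType) (V : lmodType K).

(* Equivalent to [mu x x = 0], as the characteristic is 0. *)
Definition skew_symmetric (mu : V -> V -> V) : Prop :=
  forall x y, mu x y = - mu y x.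

Definition jacobi (mu : V -> V -> V) : Prop :=
  forall x y z, mu (mu x y) z + mu (mu y z) x + mu (mu z x) y = 0.

Definition is_lie_bracket (mu : {bilinear V -> V -> V}) : Prop :=
  skew_symmetric mu /\ jacobi mu.

End LieAlgebras.

Definition lie_isomorphic (K : numFieldType) (V W : lmodType K)
    (mu : V -> V -> V) (nu : W -> W -> W) : Prop :=
  exists2 f : {linear V -> W},
    bijective f & forall x y, f (mu x y) = nu (f x) (f y).

Section Forms.
Variables (K : numFieldType) (V : lmodType K).

(* Elements of Lambda^k(V^* ) are represented by their underlying functions of
   k vectors; multilinearity and alternation are not recorded in the type. *)
Definition form (k : nat) : Type := ('I_k -> V) -> K.

Definition form1 (w : {scalar V}) : form 1 := fun v => w (v ord0).

(* Normalised so that [wedge (form1 a) (form1 b)] maps [(x, y)] to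
   [a x * b y - a y * b x]. *)
Definition wedge (k l : nat) (a : form k) (b : form l) : form (k + l) :=
  fun v => (k`! * l`!)%:R^-1 *
    \sum_(s : 'S_(k + l)) (-1) ^+ s *
      (a (fun i => v (s (lshift l i))) * b (fun j => v (s (rshift k j)))).

(* [k + p * k] is convertible to [p.+1 * k]. *)
Fixpoint wedge_exp (k : nat) (a : form k) (p : nat) : form (p * k) :=
  match p return form (p * k) with
  | 0 => fun=> 1
  | p'.+1 => wedge a (@wedge_exp k a p')
  end.
Arguments wedge_exp {k} a p v.

Definition ext_deriv (mu : V -> V -> V) (w : {scalar V}) : form 2 :=
  fun v => - w (mu (v ord0) (v ord_max)).

Definition contact_form (p : nat) (mu : V -> V -> V) (w : {scalar V}) : Prop :=
  exists v, wedge (form1 w) (wedge_exp (ext_deriv mu w) p) v != 0.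

End Forms.

Section Deformations.
Variables (K : numFieldType) (V : lmodType K).

(* The last condition is the vanishing of the coefficient of t^n in the
   Jacobi identity for [\sum_i t^i phi_i]. *)
Definition formal_deformation (mu0 : V -> V -> V)
    (phi : nat -> {bilinear V -> V -> V}) : Prop :=
  [/\ forall x y, phi 0 x y = mu0 x y,
      forall i, skew_symmetric (phi i)
    & forall n x y z, \sum_(i < n.+1)
        (phi i (phi (n - i)%N x y) z + phi i (phi (n - i)%N y z) x
         + phi i (phi (n - i)%N z x) y) = 0].

Definition quadratic (phi : nat -> {bilinear V -> V -> V}) : Prop :=
  forall i, (3 <= i)%N -> forall x y, phi i x y = 0.

(* The value at the parameter [t] of a quadratic deformation. *)
Definition quadratic_at (phi : nat -> {bilinear V -> V -> V}) (t : K) :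
    V -> V -> V :=
  fun x y => phi 0 x y + t *: phi 1 x y + t ^+ 2 *: phi 2 x y.

End Deformations.

Section Heisenberg.
Variables (K : numFieldType) (p : nat).

(* With 0-based indices, the basis vector X_(i+1) is [heis_basis i]. *)
Definition heis_basis (i : nat) : 'rV[K]_(p.*2.+1) := delta_mx 0 (inord i).

Definition heis (x y : 'rV[K]_(p.*2.+1)) : 'rV[K]_(p.*2.+1) :=
  (\sum_(k < p) (x 0 (inord k.*2) * y 0 (inord k.*2.+1)
                 - x 0 (inord k.*2.+1) * y 0 (inord k.*2)))
    *: heis_basis p.*2.

Lemma heis_is_bilinear :
  bilinear_for (GRing.Scale.Law.clone _ _ *:%R _)
    (GRing.Scale.Law.clone _ _ *:%R _) heis.
Proof.
split=> [y|x] a u v; rewrite /heis /= scalerA -scalerDl; congr (_ *: _);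
  rewrite mulr_sumr -big_split; apply: eq_bigr => k _;
  rewrite !mxE !(mulrDl, mulrDr) opprD.
- by rewrite !mulrN !mulrA addrACA.
- by rewrite !mulrN !(mulrCA _ a) addrACA.
Qed.

HB.instance Definition _ :=
  bilinear_isBilinear.Build K 'rV[K]_(p.*2.+1) 'rV[K]_(p.*2.+1)
    'rV[K]_(p.*2.+1) _ _ heis heis_is_bilinear.

Lemma heis_is_lie : is_lie_bracket heis.
Proof.
split=> [x y|x y z].
  rewrite /= /heis -scaleNr -sumrN; congr (_ *: _); apply: eq_bigr => k _.
  by rewrite opprB mulrC [X in _ - X]mulrC.
have heis0 (u v w : 'rV[K]_(p.*2.+1)) : heis (heis u v) w = 0.
  rewrite {1}/heis big1 ?scale0r // => k _.
  have l2k : (k.*2.+1 < p.*2)%N by rewrite ltn_Sdouble.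
  rewrite !mxE -!val_eqE /= !inordK; first last;
    try by rewrite ltnS // ltnW // ltnW.
  by rewrite !ltn_eqF ?(ltnW l2k) //= !mulr0 !mul0r subrr.
by rewrite /= !heis0 !addr0.
Qed.

Lemma heis_basisE (i j : nat) : (i < j < p.*2.+1)%N ->
  heis (heis_basis i) (heis_basis j) =
  if [&& ~~ odd i, j == i.+1 & (j < p.*2)%N] then heis_basis p.*2 else 0.
Proof.
case/andP=> ij jp; have ip := ltn_trans ij jp.
have E (k : 'I_p) (l m : nat) : (l < p.*2.+1)%N -> (m < p.*2.+1)%N ->
    heis_basis l 0 (inord m) = (m == l)%:R.
  by move=> lp mp; rewrite mxE -!val_eqE /= !inordK.
rewrite /heis.
rewrite (eq_bigr (fun k : 'I_p => ((k.*2 == i) && (k.*2.+1 == j))%:R));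
    last first.
  move=> k _; have l2k : (k.*2.+1 < p.*2)%N by rewrite ltn_Sdouble.
  rewrite !E ?ltnS //; try by [apply: ltnW | apply: ltnW; apply: ltnW].
  rewrite -!natrM !mulnb [X in _ - X%:R](_ : _ = 0) ?subr0 //.
  case: eqP => // ki; case: eqP => // kj.
  by move: ij; rewrite -ki -kj ltnNge leqnSn.
case: ifP => [/and3P[ei /eqP ji jp2]|H].
  have ik : (i./2 < p)%N by rewrite -ltn_double even_halfK // (ltn_trans ij).
  rewrite (bigD1 (Ordinal ik)) //= even_halfK // ji !eqxx big1 ?addr0 ?scale1r //.
  move=> k kE; case: eqP => // ki.
  by move: kE; rewrite -val_eqE /= -ki doubleK eqxx.
rewrite big1 ?scale0r // => k _; case: eqP => // ki; case: eqP => // kj.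
move: H; rewrite -ki -kj odd_double eqxx /=.
by rewrite ltn_Sdouble ltn_ord.
Qed.

End Heisenberg.

(* Main.v *)
(* The contact condition makes dw nondegenerate on ker w: the form w /\ (dw)^p
   is alternating of top degree and vanishes as soon as one argument lies in
   both ker w and the radical of dw.  Hence there are a Reeb vector z, with
   w z = 1 and w [z, _] = 0, and a symplectic basis a_k, b_k of ker w; in these
   coordinates the z-component of the bracket is exactly the Heisenberg bracket.
   Conjugating by the dilation of weight 1 on ker w and weight 2 on z gives
     mu_t = mu_0 + t phi_1 + t^2 phi_2,
   where phi_1 is the horizontal part of the bracket of two horizontal vectors
   and phi_2 is the bracket of a horizontal vector with z, which has no
   z-component.  The Jacobi identity holds for all t != 0, hence coefficient by
   coefficient. *)
Require Import Defs.
From mathcomp Require Import all_boot all_order all_fingroup all_algebra.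
From mathcomp Require Import complex reals ring.
From HB Require Import structures.
From Stdlib Require Import FunctionalExtensionality Classical_Prop.
Import GRing.Theory Num.Theory.
Local Open Scope ring_scope.

Set Implicit Arguments.
Unset Strict Implicit.
Unset Printing Implicit Defensive.

(** * Kernels and linear dependence by dimension count *)

Section LinearAlgebra.
Variable K : fieldType.

Lemma linear_ker_neq0 (U V : vectType K) (h : {linear U -> V}) :
  (\dim {:V} < \dim {:U})%N -> exists2 x, x != 0 & h x = 0.
Proof.
move=> ltVU; exists (vpick (lker (linfun h))).
  rewrite vpick0 -dimv_eq0; apply: contraTneq ltVU => ker0.
  rewrite -leqNgt -(limg_ker_dim (linfun h) {:U}) capfv ker0 add0n.
  exact/dimvS/subvf.
by have := memv_pick (lker (linfun h)); rewrite memv_ker lfunE => /eqP.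
Qed.

Lemma dim_rV n : \dim {:'rV[K]_n} = n.
Proof. by rewrite (dimvf 'rV[K]_n); apply: mul1n. Qed.

Definition lincomb (V : lmodType K) m (u : 'I_m -> V) (c : 'rV[K]_m) : V :=
  \sum_i c 0 i *: u i.

Lemma lincomb_is_linear (V : lmodType K) m (u : 'I_m -> V) : linear (lincomb u).
Proof.
move=> a c d; rewrite /lincomb scaler_sumr -big_split.
by apply: eq_bigr => i _; rewrite !mxE scalerDl scalerA.
Qed.

HB.instance Definition _ (V : lmodType K) m (u : 'I_m -> V) :=
  GRing.isLinear.Build K 'rV[K]_m V *:%R (lincomb u) (lincomb_is_linear u).

Lemma lincomb_dependent (V : vectType K) m (u : 'I_m -> V) :
  (\dim {:V} < m)%N -> exists2 c : 'rV[K]_m, c != 0 & lincomb u c = 0.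
Proof. by move=> ltVm; apply: linear_ker_neq0; rewrite dim_rV. Qed.

Definition linear_pack (U V : lmodType K) (f : U -> V) (fL : linear f) :
  {linear U -> V} := HB.pack f (GRing.isLinear.Build K U V *:%R f fL).

End LinearAlgebra.

(** * Multilinearity, annihilation and alternation of wedge products *)

Section Wedge.
Variables (K : numFieldType) (V : lmodType K).

(* Linearity in the slot [i], for arguments differing in that slot only; this
   relational form is stable under reindexing of the slots. *)
Definition multilinear k (a : Defs.form V k) : Prop :=
  forall i c (v v1 v2 : 'I_k -> V), v i = c *: v1 i + v2 i ->
    (forall j, j != i -> v1 j = v j /\ v2 j = v j) -> a v = c * a v1 + a v2.

Definition alternating k (a : Defs.form V k) : Prop :=
  forall (v : 'I_k -> V) i j, i != j -> v i = v j -> a v = 0.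

(** Vanishing of the interior product of [a] by [x], taken in every slot. *)
Definition annihilated k (x : V) (a : Defs.form V k) : Prop :=
  forall (v : 'I_k -> V) i, v i = x -> a v = 0.

Lemma multilinear_reindex k l (a : Defs.form V k) (s : 'I_k -> 'I_l) i c
    (v v1 v2 : 'I_l -> V) : multilinear a -> injective s ->
    v (s i) = c *: v1 (s i) + v2 (s i) ->
    (forall j, j != s i -> v1 j = v j /\ v2 j = v j) ->
  a (fun j => v (s j)) = c * a (fun j => v1 (s j)) + a (fun j => v2 (s j)).
Proof.
move=> aL s_inj vi vj; apply: (aL i) => // j ji.
by apply: vj; rewrite (inj_eq s_inj).
Qed.

Lemma wedge_multilinear k l (a : Defs.form V k) (b : Defs.form V l) :
  multilinear a -> multilinear b -> multilinear (wedge a b).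
Proof.
move=> aL bL i c v v1 v2 vi vj.
rewrite /wedge [c * _]mulrCA -mulrDr; congr (_ * _).
rewrite mulr_sumr -big_split.
apply: eq_bigr => s _ /=; rewrite [c * _]mulrCA -mulrDr; congr (_ * _).
(* The slot [(s^-1)%g i] lies in exactly one of the two blocks. The factor of that block is
   expanded; the other one never reads [v i], so it takes equal values at [v], [v1] and [v2]. *)
rewrite -(permKV s i) in vi vj.
case: (splitP ((s^-1)%g i)) => j ij.
  have {}ij: (s^-1)%g i = lshift l j by apply: val_inj.
  rewrite ij in vi vj.
  rewrite (multilinear_reindex (s := fun i0 => s (lshift l i0)) aL _ vi vj);
    last by move=> ? ? /perm_inj/lshift_inj.
  rewrite mulrDl -mulrA; congr (_ * (_ * b _) + _ * b _);
    by apply: functional_extensionality => m; case: (vj (s (rshift k m)));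
      rewrite ?(inj_eq perm_inj) ?eq_rlshift.
have {}ij: (s^-1)%g i = rshift k j by apply: val_inj.
rewrite ij in vi vj.
rewrite (multilinear_reindex (s := fun i0 => s (rshift k i0)) bL _ vi vj);
  last by move=> ? ? /perm_inj/rshift_inj.
rewrite mulrDr mulrCA; congr (_ * (a _ * _) + a _ * _);
  by apply: functional_extensionality => m; case: (vj (s (lshift l m)));
    rewrite ?(inj_eq perm_inj) ?eq_lrshift.
Qed.

Lemma wedge_annihilated k l (x : V) (a : Defs.form V k) (b : Defs.form V l) :
  annihilated x a -> annihilated x b -> annihilated x (wedge a b).
Proof.
move=> a0 b0 v i vi; rewrite /wedge big1 ?mulr0 // => s _.
rewrite -(permKV s i) in vi; case: (splitP ((s^-1)%g i)) => j ij.
  have {}ij: (s^-1)%g i = lshift l j by apply: val_inj.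
  by rewrite (a0 _ j) ?mul0r ?mulr0 // -ij.
have {}ij: (s^-1)%g i = rshift k j by apply: val_inj.
by rewrite (b0 _ j) ?mulr0 // -ij.
Qed.

(** Composing each permutation with the transposition of [i] and [j] flips its sign and leaves the
    arguments unchanged, because [v i = v j]. The sum is thus its own opposite, hence zero in
    characteristic 0. *)
Lemma wedge_alternating k l (a : Defs.form V k) (b : Defs.form V l) :
  alternating (wedge a b).
Proof.
move=> v i j ij vij; rewrite /wedge.
set S := \sum_s _; suff: S = - S.
  move/eqP; rewrite -addr_eq0 -mulr2n mulrn_eq0 /= => /eqP ->.
  by rewrite mulr0.
rewrite {}/S -sumrN [LHS](reindex_inj (mulIg (tperm i j))).
apply: eq_bigr => s _ /=.
rewrite odd_permM odd_tperm ij addbT signrN mulNr.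
have vt m : v ((s * tperm i j)%g m) = v (s m).
  by rewrite permM; case: tpermP => // ->.
by congr (- (_ * (a _ * b _))); apply: functional_extensionality => m.
Qed.

End Wedge.

(** * Nondegeneracy from the contact condition *)

Lemma annihilated_alternating_eq0 (K : numFieldType) (V : vectType K) k
    (a : Defs.form V k) (x : V) (v : 'I_k -> V) :
    multilinear a -> alternating a -> annihilated x a ->
  x != 0 -> (\dim {:V} <= k)%N -> a v = 0.
Proof.
move=> aL aA ax x0 dimV.
(* A linear relation between [x] and the [v i] has some [c j != 0] on a [v j];
   substituting it in the slot [j] gives [c j * a v = 0]. *)
pose u (i : 'I_k.+1) := if unlift ord0 i is Some j then v j else x.
have [|c c0] := lincomb_dependent u; first by rewrite ltnS.
rewrite /lincomb big_ord_recl {1}/u unlift_none.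
under eq_bigr do rewrite /u liftK.
move=> uc; have [j cj] : exists j, c 0 (lift ord0 j) != 0.
  apply/existsP; apply: contraNT c0; rewrite negb_exists => /forallP c0.
  have {}c0 j : c 0 (lift ord0 j) = 0 by apply/eqP/negPn/c0.
  move: uc; rewrite big1 ?addr0 => [/eqP|j _]; last by rewrite c0 scale0r.
  rewrite scaler_eq0 (negPf x0) orbF => /eqP c00.
  apply/eqP/rowP => i; rewrite mxE.
  by case: (unliftP ord0 i) => [m|] ->.
pose v' y i := if i == j then y else v i.
have L_lin : linear ((fun y => a (v' y)) : V -> K^o).
  move=> b y z; apply: (aL j); rewrite /v' ?eqxx // => i /negPf -> //.
have [L LE] : exists L : {linear V -> K^o}, forall y, L y = a (v' y).
  by exists (linear_pack L_lin).
(* The other terms of the relation die: [x] annihilates [a], and a [v i] with [i != j] would occupy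
   two slots. *)
have Lx : L x = 0 by rewrite LE; apply: (ax _ j); rewrite /v' eqxx.
have LZ b y : L (b *: y) = b * L y by rewrite linearZ.
have := congr1 L uc; rewrite linear0 linearD LZ Lx mulr0 add0r.
rewrite linear_sum (bigD1 j) //= big1 ?addr0 => [|i ij]; last first.
  rewrite LZ (_ : L _ = 0) ?mulr0 //.
  by rewrite LE; apply: (aA _ i j) => //=; rewrite /v' eqxx (negPf ij).
have -> : a v = L (v j).
  rewrite LE; congr a; apply: functional_extensionality => i.
  by rewrite /v'; case: eqP => [->|].
by rewrite LZ => cL; apply: (mulfI cj); rewrite mulr0.
Qed.

(** By contraposition: a nonzero such [x] annihilates [form1 w] and [ext_deriv mu w], hence their
    wedge, whose degree [1 + p * 2] is at least the dimension. *)
Lemma contact_form_nondegenerate (K : numFieldType) (V : vectType K) p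
    (mu : {bilinear V -> V -> V}) (w : {scalar V}) (x : V) :
    skew_symmetric mu -> (\dim {:V} <= p.*2.+1)%N -> contact_form p mu w ->
  w x = 0 -> (forall y, w (mu x y) = 0) -> x = 0.
Proof.
move=> muN dimV [v wv] wx wmux; apply: contraNeq wv => x0; apply/eqP.
have two (i : 'I_2) : i = ord0 \/ i = ord_max.
  by case: i => [[|[|]]] // ?; [left | right]; apply: val_inj.
have dwL : multilinear (ext_deriv mu w).
  move=> i c u u1 u2 ui uj; rewrite /ext_deriv mulrN -opprD; congr (- _).
  case: (two i) => iE; subst i.
    rewrite ui linearPl /= linearP /=.
    by rewrite (uj ord_max isT).1 (uj ord_max isT).2.
  rewrite ui linearPr /= linearP /=.
  by rewrite (uj ord0 isT).1 (uj ord0 isT).2.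
have dwx : annihilated x (ext_deriv mu w).
  move=> u i ui; rewrite /ext_deriv; case: (two i) => iE; subst i.
    by rewrite ui wmux oppr0.
  by rewrite ui muN linearN wmux !oppr0.
have [dwpL dwpx] : multilinear (wedge_exp (ext_deriv mu w) (p := p)) /\
    annihilated x (wedge_exp (ext_deriv mu w) (p := p)).
  (* The zeroth power is the constant 1, but it has no slot, so both properties hold vacuously. *)
  elim: p {dimV v} => [|p [dwpL dwpx]]; first by split=> [[]|? []].
  by split; [apply: wedge_multilinear | apply: wedge_annihilated].
apply: (@annihilated_alternating_eq0 _ _ _ _ x) => //.
- apply: wedge_multilinear => // i c u u1 u2 ui uj.
  by rewrite (ord1 i) in ui; rewrite /form1 ui linearP.
- exact: wedge_alternating.
- apply: wedge_annihilated => // u i; rewrite (ord1 i) => ui.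
  by rewrite /form1 ui.
- by rewrite add1n muln2.
Qed.

Lemma linear_inj_bijective (K : fieldType) (U V : vectType K)
    (h : {linear U -> V}) :
  (forall x, h x = 0 -> x = 0) -> \dim {:U} = \dim {:V} -> bijective h.
Proof.
move=> h0 dimUV; have ker0 : lker (linfun h) == 0%VS.
  apply/eqP/vspaceP => x; rewrite memv_ker lfunE memv0 /=.
  by apply/eqP/eqP => [/h0|->]; rewrite ?linear0.
have img : limg (linfun h) = {:V}%VS.
  apply/eqP; rewrite eqEdim subvf -dimUV.
  by rewrite -(limg_ker_dim (linfun h) {:U}) capfv (eqP ker0) dimv0 add0n leqnn.
exists (linfun h)^-1%VF => [x|y].
  by rewrite -[h x](lfunE h) lker0_lfunK.
by rewrite -[LHS](lfunE h) limg_lfunVK ?img ?memvf.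
Qed.

(** * Reeb vector and symplectic basis *)

Section DarbouxFrame.
Variables (K : numFieldType) (V : vectType K).
Variables (mu : {bilinear V -> V -> V}) (w : {scalar V}).
Hypothesis muN : skew_symmetric mu.
Hypothesis nondeg :
  forall x, w x = 0 -> (forall y, w (mu x y) = 0) -> x = 0.

Local Notation B x y := (w (mu x y)).

Lemma scalar_sum k (c : 'I_k -> K) (f : 'I_k -> V) :
  w (\sum_i c i *: f i) = \sum_i c i * w (f i).
Proof. by rewrite linear_sum; apply: eq_bigr => i _; rewrite linearZ. Qed.

Lemma pairingN x y : B x y = - B y x.
Proof. by rewrite muN linearN. Qed.

Lemma pairingDr x y1 y2 : B x (y1 + y2) = B x y1 + B x y2.
Proof. by rewrite linearDr linearD. Qed.

Lemma pairingZr x c y : B x (c *: y) = c * B x y.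
Proof. by rewrite linearZr_LR linearZ. Qed.

Lemma pairing_sumr x k (c : 'I_k -> K) (f : 'I_k -> V) :
  B x (\sum_i c i *: f i) = \sum_i c i * B x (f i).
Proof.
rewrite -scalar_sum; congr (w _).
by rewrite linear_sumr; apply: eq_bigr => i _; rewrite linearZr_LR.
Qed.

Lemma pairing_diag x : B x x = 0.
Proof.
have /eqP := pairingN x x; rewrite -addr_eq0 -mulr2n mulrn_eq0 /= => /eqP //.
Qed.

Lemma reeb_vector : odd (\dim {:V}) ->
  exists2 z, w z = 1 & forall y, B z y = 0.
Proof.
move=> dim_odd; pose b := vbasis {:V}.
pose A : 'M[K]_(\dim {:V}) := \matrix_(i, j) B (b`_i : V) (b`_j).
(* [A] is skew of odd size, hence singular. *)
have /det0P [v v0 vA] : \det A == 0.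
  have : \det A = - \det A.
    rewrite -[LHS]det_tr (_ : A^T = -1 *: A).
      by rewrite detZ -signr_odd dim_odd mulN1r.
    by apply/matrixP => i j; rewrite !mxE pairingN mulN1r.
  by move/eqP; rewrite -addr_eq0 -mulr2n mulrn_eq0.
pose z := lincomb (fun i : 'I_(\dim {:V}) => b`_i) v.
have z0 : z != 0.
  have /freeP bfree : free b := basis_free (vbasisP {:V}).
  apply: contraNneq v0 => /bfree v0.
  by apply/eqP/rowP => i; rewrite v0 mxE.
have zb y : B z y = 0.
  rewrite (coord_vbasis (memvf y)) pairing_sumr big1 // => j _.
  have -> : B z b`_j = (v *m A) 0 j.
    rewrite pairingN pairing_sumr mxE -sumrN; apply: eq_bigr => i _.
    by rewrite mxE [in RHS]pairingN mulrN.
  by rewrite vA mxE mulr0.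
(* A radical vector inside the kernel of [w] would be zero, so [z] can be rescaled. *)
have wz : w z != 0 by apply: contraNneq z0 => wz; apply/eqP/nondeg.
exists ((w z)^-1 *: z) => [|y]; first by rewrite linearZ /= mulVf.
by rewrite pairingN pairingZr pairingN zb oppr0 mulr0 oppr0.
Qed.

Variable z : V.
Hypotheses (wz : w z = 1) (zB : forall y, B z y = 0).

(** Indexing by [nat] lets the induction extend a family by overriding the value at [k]; values from
    [k] on are unconstrained. *)
Definition symplectic_family k (a b : nat -> V) : Prop :=
  forall i, (i < k)%N -> w (a i) = 0 /\ w (b i) = 0 /\
    forall j, (j < k)%N ->
      [/\ B (a i) (a j) = 0, B (b i) (b j) = 0 & B (a i) (b j) = (i == j)%:R].

(** Symplectic Gram-Schmidt: each step adds a vector orthogonal to the previous pairs, then a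
    partner for it. *)
Lemma symplectic_family_exists p k : \dim {:V} = p.*2.+1 -> (k <= p)%N ->
  exists a b, symplectic_family k a b.
Proof.
move=> dimV; elim: k => [_|k IHk ltkp]; first by exists (fun=> 0), (fun=> 0).
have [a [b ab]] := IHk (ltnW ltkp).
(* The new vector must satisfy [2k + 1] linear conditions: orthogonality to [k] vectors [a], to [k]
   vectors [b], and [w x = 0]. Since [k < p], a nonzero solution remains. *)
have h_lin : linear (fun x => \row_(j < k.*2.+1)
    (if (j < k)%N then B (a j) x
     else if (j < k.*2)%N then B (b (j - k)%N) x else w x)).
  move=> c x y; apply/rowP => j; rewrite !mxE.
  do 2![case: ifP => _; first by rewrite pairingDr pairingZr].
  by rewrite linearP.
have [|x x0 /= /rowP hx] := linear_ker_neq0 (linear_pack h_lin).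
  by rewrite dim_rV dimV ltnS ltn_double.
have ax i : (i < k)%N -> B (a i) x = 0.
  move=> ik; have i2k : (i < k.*2.+1)%N.
    by rewrite ltnS -addnn (leq_trans (ltnW ik)) ?leq_addr.
  by have := hx (Ordinal i2k); rewrite !mxE /= ik.
have bx i : (i < k)%N -> B (b i) x = 0.
  move=> ik; have i2k : (k + i < k.*2)%N by rewrite -addnn ltn_add2l.
  have := hx (Ordinal (ltnW i2k : (k + i < k.*2.+1)%N)).
  by rewrite !mxE /= ltnNge leq_addr /= i2k addKn.
have wx : w x = 0.
  have := hx ord_max; rewrite !mxE /= ltnn ltnNge -addnn leq_addr //.
have [y0 xy0] : exists y, B x y != 0.
  apply: NNPP => xy; case/negP: x0; apply/eqP/nondeg => // y.
  by apply/eqP/negPn/negP => xy0; case: xy; exists y.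
have [y1 xy1] : exists y1, B x y1 = 1.
  by exists ((B x y0)^-1 *: y0); rewrite pairingZr mulVf.
(* The [z] term brings [y1] into the kernel of [w]; the two sums cancel its pairings with the
   earlier [a i] and [b i]. All corrections pair to zero with [x], so [B x y] stays 1. *)
pose y := y1 + (- w y1) *: z + \sum_(i < k) (- B (a i) y1) *: b i
  + \sum_(i < k) B (b i) y1 *: a i.
have xy : B x y = 1.
  rewrite !pairingDr !pairing_sumr pairingZr.
  rewrite (pairingN x z) zB oppr0 mulr0 addr0 xy1.
  rewrite !big1 ?addr0 // => i _;
    by rewrite [B x _]pairingN ?ax ?bx // oppr0 mulr0.
have wy : w y = 0.
  rewrite !linearD linearZ !scalar_sum /= wz mulr1 subrr.
  by rewrite !big1 ?addr0 // => i _; have [wa [wb _]] := ab i (ltn_ord i);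
    rewrite ?wa ?wb mulr0.
have ay i : (i < k)%N -> B (a i) y = 0.
  move=> ik; rewrite !pairingDr !pairing_sumr pairingZr.
  rewrite (pairingN (a i) z) zB oppr0 mulr0 addr0.
  rewrite [X in _ + X]big1 ?addr0 => [|j _]; last first.
    by have [_ [_ /(_ _ (ltn_ord j)) [-> _ _]]] := ab i ik; rewrite mulr0.
  rewrite (bigD1 (Ordinal ik)) //= big1 ?addr0 => [|j ji]; last first.
    have [_ [_ /(_ _ (ltn_ord j)) [_ _ ->]]] := ab i ik.
    by rewrite (_ : (i == j) = false) ?mulr0 // eq_sym; apply/negbTE.
  have [_ [_ /(_ _ ik) [_ _ ->]]] := ab i ik.
  by rewrite eqxx mulr1 subrr.
have yb i : (i < k)%N -> B (b i) y = 0.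
  move=> ik; rewrite !pairingDr !pairing_sumr pairingZr.
  rewrite (pairingN (b i) z) zB oppr0 mulr0 addr0.
  rewrite [X in _ + X + _]big1 ?addr0 => [|j _]; last first.
    by have [_ [_ /(_ _ (ltn_ord j)) [_ -> _]]] := ab i ik; rewrite mulr0.
  rewrite (bigD1 (Ordinal ik)) //= big1 ?addr0 => [|j ji]; last first.
    have [_ [_ /(_ _ ik) [_ _ abji]]] := ab j (ltn_ord j).
    rewrite [B (b i) _]pairingN abji (_ : (_ == i) = false) ?oppr0 ?mulr0 //.
    exact/negbTE.
  have [_ [_ /(_ _ ik) [_ _ abii]]] := ab i ik.
  by rewrite [B (b i) (a i)]pairingN abii eqxx mulrN1 subrr.
exists (fun i => if i == k then x else a i),
  (fun i => if i == k then y else b i).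
move=> i; rewrite ltnS leq_eqVlt; have [-> _ /=|ik /= ltik] := eqVneq i k.
  split=> //; split=> // j; rewrite ltnS leq_eqVlt.
  have [-> _ /=|jk /= ltjk] := eqVneq j k.
    by rewrite !pairing_diag xy.
  by rewrite pairingN ax // [B y _]pairingN yb // [B x _]pairingN bx // oppr0.
have [wa [wb abi]] := ab i ltik; split=> //; split=> // j.
rewrite ltnS leq_eqVlt; have [-> _ /=|jk /= ltjk] := eqVneq j k.
  by rewrite ax // yb // ay // (negPf ik).
exact: abi.
Qed.

End DarbouxFrame.

(** * Adapted coordinates; [heis_form] is the standard symplectic form on the first [2p]
    coordinates *)

Definition heis_form (K : numFieldType) p (x y : 'rV[K]_(p.*2.+1)) : K :=
  \sum_(k < p) (x 0 (inord k.*2) * y 0 (inord k.*2.+1)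
                - x 0 (inord k.*2.+1) * y 0 (inord k.*2)).

(** The frame interleaves the symplectic pairs as [a 0, b 0, a 1, b 1, ...] and ends with the Reeb
    vector, matching the order of the Heisenberg basis. *)
Lemma contact_frame (K : numFieldType) (V : vectType K) p
    (mu : {bilinear V -> V -> V}) (w : {scalar V}) :
    skew_symmetric mu -> \dim {:V} = p.*2.+1 -> contact_form p mu w ->
  exists F : {linear 'rV[K]_(p.*2.+1) -> V}, [/\ bijective F,
    forall x, w (F x) = x 0 (inord p.*2) &
    forall x y, w (mu (F x) (F y)) = heis_form x y].
Proof.
move=> muN dimV cw.
have nondeg x : w x = 0 -> (forall y, w (mu x y) = 0) -> x = 0.
  by apply: contact_form_nondegenerate cw; rewrite ?dimV.
have [|z wz zB] := reeb_vector muN nondeg; first by rewrite dimV /= odd_double.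
have [a [b ab]] := symplectic_family_exists muN nondeg wz zB dimV (leqnn p).
pose f (x : 'rV[K]_(p.*2.+1)) := x 0 (inord p.*2) *: z
  + \sum_(k < p) x 0 (inord k.*2) *: a k
  + \sum_(k < p) x 0 (inord k.*2.+1) *: b k.
have f_lin : linear f.
  move=> c x y; rewrite /f !scalerDr addrACA (addrACA (c *: _)).
  congr (_ + _ + _); first by rewrite !mxE scalerDl scalerA.
    rewrite scaler_sumr -big_split; apply: eq_bigr => k _.
    by rewrite !mxE scalerDl scalerA.
  rewrite scaler_sumr -big_split; apply: eq_bigr => k _.
  by rewrite !mxE scalerDl scalerA.
have [F FE] : exists F : {linear 'rV[K]_(p.*2.+1) -> V}, F =1 f.
  by exists (linear_pack f_lin).
have wF x : w (F x) = x 0 (inord p.*2).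
  rewrite FE /f !linearD !scalar_sum linearZ /= wz mulr1.
  by rewrite !big1 ?addr0 // => i _; have [wa [wb _]] := ab i (ltn_ord i);
    rewrite ?wa ?wb mulr0.
(* Pairing with [a i] or [b i] reads off one coordinate up to sign. This serves both for injectivity
   of [F] and for the formula of the pairing. *)
have aF x (i : 'I_p) : w (mu (a i) (F x)) = x 0 (inord i.*2.+1).
  rewrite FE /f !pairingDr !pairing_sumr pairingZr.
  rewrite (pairingN w muN _ z) zB oppr0 mulr0 add0r.
  have [_ [_ abi]] := ab i (ltn_ord i).
  rewrite big1 ?add0r => [|j _]; last first.
    by have [-> _ _] := abi j (ltn_ord j); rewrite mulr0.
  rewrite (bigD1 i) //= big1 ?addr0 => [|j ji]; last first.
    have [_ _ ->] := abi j (ltn_ord j).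
    by rewrite (_ : (_ == _) = false) ?mulr0 // eq_sym; apply/negbTE.
  by have [_ _ ->] := abi i (ltn_ord i); rewrite eqxx mulr1.
have bF x (i : 'I_p) : w (mu (b i) (F x)) = - x 0 (inord i.*2).
  rewrite FE /f !pairingDr !pairing_sumr pairingZr.
  rewrite (pairingN w muN _ z) zB oppr0 mulr0 add0r.
  have [_ [_ abi]] := ab i (ltn_ord i).
  rewrite [X in _ + X]big1 ?addr0 => [|j _]; last first.
    by have [_ -> _] := abi j (ltn_ord j); rewrite mulr0.
  rewrite (bigD1 i) //= big1 ?addr0 => [|j ji]; last first.
    have [_ [_ /(_ _ (ltn_ord i)) [_ _ abji]]] := ab j (ltn_ord j).
    rewrite (pairingN w muN) abji (_ : (_ == _) = false) ?oppr0 ?mulr0 //.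
    exact/negbTE.
  have [_ _ abii] := abi i (ltn_ord i).
  by rewrite (pairingN w muN) abii eqxx mulrN1.
exists F; split=> // [|x y].
  apply: linear_inj_bijective => [x Fx|]; last by rewrite dim_rV dimV.
  apply/rowP => i; rewrite mxE -(inord_val i).
  have [ip|] := ltnP i p.*2; last first.
    move=> pi; have -> : i = p.*2 :> nat.
      by apply/eqP; rewrite eqn_leq pi -ltnS ltn_ord.
    by rewrite -wF Fx linear0.
  have i2p : (i./2 < p)%N by rewrite -ltn_double (leq_ltn_trans _ ip) //
    -[X in (_ <= X)%N]odd_double_half leq_addl.
  rewrite -[X in inord X]odd_double_half; case: (odd i).
    by rewrite -(aF x (Ordinal i2p)) Fx linear0r linear0.
  by apply: oppr_inj; rewrite -(bF x (Ordinal i2p)) Fx linear0r linear0 oppr0.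
(* Only [F x] is expanded in the frame; [aF] and [bF] then evaluate the pairings with [F y]. *)
rewrite (pairingN w muN) (FE x) /f !pairingDr !pairing_sumr pairingZr.
rewrite (pairingN w muN _ z) zB oppr0 mulr0 add0r.
rewrite -big_split -sumrN; apply: eq_bigr => k _ /=.
rewrite (pairingN w muN _ (a k)) (pairingN w muN _ (b k)) aF bF.
by rewrite opprK mulrN opprD opprK.
Qed.

(** * Isomorphisms, and the Jacobi identity power by power in [t] *)

Definition bilinear_pack (K : comNzRingType) (U V W : lmodType K)
    (f : U -> V -> W)
    (fB : bilinear_for (GRing.Scale.Law.clone _ _ *:%R _)
            (GRing.Scale.Law.clone _ _ *:%R _) f) : {bilinear U -> V -> W} :=
  HB.pack f (bilinear_isBilinear.Build K U V W _ _ f fB).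

Lemma lie_isomorphic_sym (K : numFieldType) (V W : lmodType K)
    (mu : V -> V -> V) (nu : W -> W -> W) :
  lie_isomorphic mu nu -> lie_isomorphic nu mu.
Proof.
case=> f [h fK hK] fmu.
exists (linear_pack (can2_linear fK hK)) => [|x y]; first by exists f.
by apply: (can_inj fK); rewrite /= fmu !hK.
Qed.

(** A nonzero polynomial of size at most [n] has fewer than [n] roots, while 1, ..., [n] are [n]
    distinct nonzero scalars in characteristic 0. *)
Lemma coef_eq0_of_eval_eq0 (K : numFieldType) (n : nat) (c : nat -> K) :
    (forall t, t != 0 -> \sum_(i < n) t ^+ i * c i = 0) ->
  forall i, (i < n)%N -> c i = 0.
Proof.
move=> ct i ltin; pose q := \poly_(i < n) c i.
have -> : c i = q`_i by rewrite coef_poly ltin.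
suff -> : q = 0 by rewrite coef0.
apply/eqP; apply: contraT => q0.
pose rs : seq K := [seq k.+1%:R | k <- iota 0 n].
have rs_uniq : uniq rs.
  rewrite map_inj_uniq ?iota_uniq // => k l /eqP.
  by rewrite eqr_nat eqSS => /eqP.
have rs_root : all (root q) rs.
  apply/allP => _ /mapP [k _ ->]; rewrite /root horner_poly.
  rewrite (eq_bigr (fun i : 'I_n => k.+1%:R ^+ i * c i)); last first.
    by move=> j _; rewrite mulrC.
  by rewrite ct ?pnatr_eq0.
have := leq_trans (max_poly_roots q0 rs_root rs_uniq) (size_poly _ _).
by rewrite size_map size_iota ltnn.
Qed.

Lemma quadratic_jacobi (K : numFieldType) d
    (phi : nat -> {bilinear 'rV[K]_d -> 'rV[K]_d -> 'rV[K]_d}) :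
    quadratic phi -> (forall t, t != 0 -> jacobi (quadratic_at phi t)) ->
  forall n x y z, \sum_(i < n.+1)
    (phi i (phi (n - i)%N x y) z + phi i (phi (n - i)%N y z) x
     + phi i (phi (n - i)%N z x) y) = 0.
Proof.
move=> phi3 jac n x y z.
pose T i j := phi i (phi j x y) z + phi i (phi j y z) x + phi i (phi j z x) y.
have T0 i j : (3 <= i)%N || (3 <= j)%N -> T i j = 0.
  case/orP => le3; first by rewrite /T !(phi3 _ le3) !addr0.
  by rewrite /T !(phi3 _ le3) !linear0l !addr0.
(* [T i j] contributes in degree [i + j] and vanishes once an index reaches 3. So degrees from 5 on
   are trivial, and the remaining five are the coefficients of a polynomial of degree at most 4. *)
rewrite -[LHS]/(\sum_(i < n.+1) T i (n - i)%N).
have [lt5n|] := ltnP n 5; last first.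
  move=> le5n; apply: big1 => i _; apply: T0.
  by case: leqP => //= lti3; rewrite ltn_subRL (leq_trans _ le5n) //
    addn2 ltnS ltnS.
apply/rowP => m; rewrite [RHS]mxE.
pose c n := (\sum_(i < n.+1) T i (n - i)%N) 0 m.
apply: (coef_eq0_of_eval_eq0 (n := 5) (c := c)) lt5n => t t0.
have := congr1 (fun v : 'rV_d => v 0 m) (jac t t0 x y z).
rewrite [RHS]mxE => jac0; rewrite -[RHS]jac0.
rewrite /c !big_ord_recr !big_ord0 /= !add0r.
rewrite [T 0 3]T0 // [T 0 4]T0 // [T 1 3]T0 //.
rewrite [T 3 0]T0 // [T 3 1]T0 // [T 4 0]T0 //.
rewrite /T /quadratic_at !linearDl /= !linearZl_LR.
by rewrite !mxE; ring.
Qed.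

(** * Weighted dilations and the deformation of the Heisenberg bracket *)

Section Contraction.
Variables (K : numFieldType) (p : nat).
Local Notation W := 'rV[K]_(p.*2.+1).
Implicit Types x y z : W.

Local Notation e := (heis_basis K p p.*2).
Local Notation reeb_coord x := (x 0 (inord p.*2)).

Definition horizontal x : W := x - reeb_coord x *: e.

(** The weights 1 and 2 make it an endomorphism of [heis], which is why the constant term of the
    deformation is the Heisenberg bracket. *)
Definition dilation (t : K) x : W :=
  t *: horizontal x + t ^+ 2 *: (reeb_coord x *: e).

Lemma horizontal_is_linear : linear horizontal.
Proof.
move=> a x y; rewrite /horizontal !mxE scalerDl -scalerA scalerBr opprD.
exact: addrACA.
Qed.

HB.instance Definition _ :=
  GRing.isLinear.Build K W W *:%R horizontal horizontal_is_linear.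

Lemma dilation_is_linear t : linear (dilation t).
Proof.
by move=> a x y; apply/rowP => m; rewrite /dilation linearP !mxE; ring.
Qed.

HB.instance Definition _ t :=
  GRing.isLinear.Build K W W *:%R (dilation t) (dilation_is_linear t).

Lemma heis_basis_lastE : reeb_coord e = 1.
Proof. by rewrite mxE !eqxx. Qed.

Lemma horizontalK x : horizontal x + reeb_coord x *: e = x.
Proof. exact: subrK. Qed.

Lemma dilation_horizontal t x : reeb_coord x = 0 -> dilation t x = t *: x.
Proof.
by rewrite /dilation /horizontal => ->; rewrite scale0r subr0 scaler0 addr0.
Qed.

Lemma dilation_reeb t c : dilation t (c *: e) = (t ^+ 2 * c) *: e.
Proof.
rewrite /dilation /horizontal mxE heis_basis_lastE mulr1 subrr scaler0 add0r.
by rewrite scalerA.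
Qed.

Lemma dilation_bijective t : t != 0 -> bijective (dilation t).
Proof.
move=> t0; apply: linear_inj_bijective => // x.
move=> /= Dx; have x0 : reeb_coord x = 0.
  have := congr1 (fun v : W => reeb_coord v) Dx.
  rewrite /dilation !mxE !eqxx !mulr1 subrr mulr0 add0r => /eqP.
  by rewrite mulf_eq0 expf_eq0 (negPf t0) => /eqP.
move: Dx; rewrite dilation_horizontal // => /eqP.
by rewrite scaler_eq0 (negPf t0) => /eqP.
Qed.

Lemma heisE x y : heis x y = heis_form x y *: e.
Proof. by []. Qed.

Lemma heis_basis_last_coord (k : 'I_p) :
  e 0 (inord k.*2) = 0 /\ e 0 (inord k.*2.+1) = 0.
Proof.
have lt2k : (k.*2.+1 < p.*2)%N by rewrite ltn_Sdouble.
rewrite !mxE -!val_eqE /= !inordK ?ltnS //; try by rewrite ltnW // ltnW.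
by rewrite !ltn_eqF ?(ltnW lt2k).
Qed.

Lemma heis_form_reeb x c : heis_form x (c *: e) = 0.
Proof.
rewrite /heis_form big1 // => k _; have [e0 e1] := heis_basis_last_coord k.
by rewrite ![(c *: e) _ _]mxE e0 e1 !mulr0 subrr.
Qed.

Lemma heis_formN x y : heis_form x y = - heis_form y x.
Proof.
by rewrite -sumrN; apply: eq_bigr => k _; rewrite opprB mulrC [X in _ - X]mulrC.
Qed.

Lemma heis_formDr x y z : heis_form x (y + z) = heis_form x y + heis_form x z.
Proof.
rewrite -big_split; apply: eq_bigr => k _ /=; rewrite !mxE; ring.
Qed.

Lemma heis_form_horizontal x y :
  heis_form (horizontal x) (horizontal y) = heis_form x y.
Proof.
have horr u v : heis_form u (horizontal v) = heis_form u v.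
  by rewrite -[in RHS](horizontalK v) heis_formDr heis_form_reeb addr0.
by rewrite horr heis_formN horr -heis_formN.
Qed.

Variable mu : {bilinear W -> W -> W}.
Hypothesis mu_lie : is_lie_bracket mu.
Hypothesis mu_contact : forall x y, reeb_coord (mu x y) = heis_form x y.

Lemma contact_bracket_deformation :
  exists phi : nat -> {bilinear W -> W -> W},
    [/\ formal_deformation (@heis K p) phi, quadratic phi
      & forall t, t != 0 -> lie_isomorphic (quadratic_at phi t) mu].
Proof.
have [muN muJ] := mu_lie.
pose Q x : W := reeb_coord x *: e.
have QP a x y : Q (a *: x + y) = a *: Q x + Q y.
  by rewrite /Q !mxE scalerDl scalerA.
have [phi1 phi1E] : exists f : {bilinear W -> W -> W}, forall x y,
    f x y = mu (horizontal x) (horizontal y) - heis x y.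
  suff fB : bilinear_for (GRing.Scale.Law.clone _ _ *:%R _)
      (GRing.Scale.Law.clone _ _ *:%R _)
      (fun x y => mu (horizontal x) (horizontal y) - heis x y).
    by exists (bilinear_pack fB).
  split=> [y|x] a u v /=.
    by rewrite linearP !linearPl scalerBr opprD addrACA.
  by rewrite [horizontal (_ + _)]linearP !linearPr scalerBr opprD addrACA.
have [phi2 phi2E] : exists f : {bilinear W -> W -> W}, forall x y,
    f x y = mu (horizontal x) (Q y) + mu (Q x) (horizontal y).
  suff fB : bilinear_for (GRing.Scale.Law.clone _ _ *:%R _)
      (GRing.Scale.Law.clone _ _ *:%R _)
      (fun x y => mu (horizontal x) (Q y) + mu (Q x) (horizontal y)).
    by exists (bilinear_pack fB).
  split=> [y|x] a u v /=.
    by rewrite QP linearP !linearPl scalerDr addrACA.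
  by rewrite QP [horizontal (_ + _)]linearP !linearPr scalerDr addrACA.
have [zero zeroE] : exists f : {bilinear W -> W -> W}, forall x y, f x y = 0.
  suff fB : bilinear_for (GRing.Scale.Law.clone _ _ *:%R _)
      (GRing.Scale.Law.clone _ _ *:%R _) (fun _ _ : W => 0 : W).
    by exists (bilinear_pack fB).
  by split=> [y|x] a u v /=; rewrite scaler0 addr0.
pose phi n : {bilinear W -> W -> W} :=
  match n with 0 => @heis K p | 1 => phi1 | 2 => phi2 | _ => zero end.
have phi3 : quadratic phi by move=> [|[|[|i]]].
(* This removes the term of weight 4 from [mu (dilation t x) (dilation t y)]. *)
have muQQ x y : mu (Q x) (Q y) = 0.
  have ee : mu e e = 0.
    have /eqP := muN e e; rewrite -addr_eq0 -mulr2n -scaler_nat scaler_eq0.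
    by rewrite pnatr_eq0 => /eqP.
  by rewrite linearZr_LR /= linearZl_LR ee !scaler0.
have phi1h x y : reeb_coord (phi1 x y) = 0.
  rewrite phi1E mxE mu_contact heis_form_horizontal heisE !mxE !eqxx mulr1.
  exact: subrr.
have phi2h x y : reeb_coord (phi2 x y) = 0.
  rewrite phi2E mxE !mu_contact heis_form_reeb [X in _ + X]heis_formN.
  by rewrite heis_form_reeb oppr0 addr0.
have mu_weighted (t : K) u u' v v' :
    mu (t *: u + t ^+ 2 *: u') (t *: v + t ^+ 2 *: v') =
    t ^+ 2 *: mu u v + t ^+ 3 *: (mu u v' + mu u' v) + t ^+ 4 *: mu u' v'.
  rewrite linearDr /= !linearDl !linearZr_LR /= !linearZl_LR /=.
  by apply/rowP => m; rewrite !mxE; ring.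
(* As [phi1] and [phi2] take horizontal values, [dilation t] multiplies them by [t] and multiplies
   the [e] part by [t ^+ 2]. Both sides become [t ^+ 2] times the horizontal bracket plus
   [t ^+ 3 *: phi2 x y]. *)
have phi_mu t x y :
    dilation t (quadratic_at phi t x y) = mu (dilation t x) (dilation t y).
  rewrite [RHS]mu_weighted -/(Q x) -/(Q y) muQQ -phi2E scaler0 addr0.
  have -> : mu (horizontal x) (horizontal y) = phi1 x y + heis_form x y *: e.
    by rewrite phi1E subrK.
  rewrite -[quadratic_at _ _ _ _]/(heis_form x y *: e + t *: phi1 x y
    + t ^+ 2 *: phi2 x y) !linearD /= dilation_reeb.
  rewrite !dilation_horizontal; try by rewrite mxE ?phi1h ?phi2h mulr0.
  by apply/rowP => m; rewrite !mxE; ring.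
have jac t : t != 0 -> jacobi (quadratic_at phi t).
  move=> t0 x y z; apply: (bij_inj (dilation_bijective t0)).
  by rewrite linear0 2!linearD /= !phi_mu muJ.
exists phi; split=> // [|t t0].
  split=> // [i x y|]; last exact: quadratic_jacobi.
  case: i => [|[|[|i]]] /=.
  - exact: (heis_is_lie K p).1.
  - by rewrite !phi1E muN (heis_is_lie K p).1 opprB opprK addrC.
  - by rewrite !phi2E muN [mu (Q x) _]muN opprD addrC.
  - by rewrite !zeroE oppr0.
by exists (dilation t); [apply: dilation_bijective | apply: phi_mu].
Qed.

End Contraction.

(** * Transport from the original Lie algebra *)

Lemma lie_isomorphic_trans (K : numFieldType) (U V W : lmodType K)
    (mu : U -> U -> U) (nu : V -> V -> V) (rho : W -> W -> W) :
  lie_isomorphic mu nu -> lie_isomorphic nu rho -> lie_isomorphic mu rho.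
Proof.
case=> f f_bij fmu [h h_bij hnu]; exists (h \o f); first exact: bij_comp.
by move=> x y /=; rewrite fmu hnu.
Qed.

Theorem theorem14 (R : realType) (K : numFieldType) (hK : real_or_complex R K)
    (p : nat) (hp : (1 <= p)%N)
    (g : vectType K) (br : {bilinear g -> g -> g})
    (hbr : is_lie_bracket br)
    (hdim : \dim {:g} = p.*2.+1)
    (hcontact : exists w : {scalar g}, contact_form p br w) :
  exists phi : nat -> {bilinear 'rV[K]_(p.*2.+1) -> 'rV[K]_(p.*2.+1)
                        -> 'rV[K]_(p.*2.+1)},
    [/\ formal_deformation (@heis K p) phi,
        quadratic phi
      & forall t : K, t != 0 -> lie_isomorphic br (quadratic_at phi t)].
Proof.
have [brN brJ] := hbr; have [w cw] := hcontact.
have [F [[G FK GK] wF BF]] := contact_frame brN hdim cw.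
have G_lin : linear G := can2_linear FK GK.
(* [mu] is the bracket [br] read in the adapted coordinates, so its last coordinate is
   [heis_form]. *)
have [mu muE] : exists mu : {bilinear 'rV[K]_(p.*2.+1) -> 'rV[K]_(p.*2.+1)
    -> 'rV[K]_(p.*2.+1)}, forall x y, mu x y = G (br (F x) (F y)).
  suff fB : bilinear_for (GRing.Scale.Law.clone _ _ *:%R _)
      (GRing.Scale.Law.clone _ _ *:%R _) (fun x y => G (br (F x) (F y))).
    by exists (bilinear_pack fB).
  by split=> [y|x] a u v /=; rewrite linearP ?linearPl ?linearPr -G_lin.
have Fmu x y : F (mu x y) = br (F x) (F y) by rewrite muE GK.
have F_inj : injective F := can_inj FK.
have mu_lie : is_lie_bracket mu.
  split=> [x y|x y z]; apply: F_inj; first by rewrite linearN !Fmu brN.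
  by rewrite !linearD linear0 /= !Fmu brJ.
have [|phi [phi_def phi_quad phi_iso]] := contact_bracket_deformation mu_lie.
  by move=> x y; rewrite -wF Fmu BF.
exists phi; split=> // t t0; apply: lie_isomorphic_sym.
apply: lie_isomorphic_trans (phi_iso t t0) _.
by exists F; first by exists G.
Qed.
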